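(* Consider an instance of $P2,S1|s_j,t_j|C_{max}$ with jobs $J_1,\dots,J_n$ such that $p_j<s_i$ for all $i,j\in\{1,\dots,n\}$. Then all permutations of the jobs define an optimal solution, and the optimal makespan is equal to the sum of the lengths of all jobs: $C_{max}^{*}=\sum_{j=1}^{n}A_j$.
   Context: Problem $P2,S1|s_j,t_j|C_{max}$: there are $n$ independent jobs $J_1,\dots,J_n$, all available at time $0$, each with loading time $s_j>0$, integer processing time $p_j>0$ and unloading time $t_j>0$; two identical parallel machines; and one server. Each job is assigned to one machine, where it is loaded by the server, then processed, then unloaded by the server, with no delay between loading and processing nor between processing and unloading. A machine handles at most one job at a time and is occupied throughout loading, processing and unloading; the server performs at most one loading or unloading operation at a time. No preemption. The objective is to minimize the makespan $C_{max}$ (the largest time at which the unloading of a job ends); $C_{max}^*$ is its optimal value. $A_j=s_j+p_j+t_j$ is the length of job $J_j$. A permutation of the jobs defines a schedule as follows: the jobs are considered in the order of the permutation, and each one is scheduled as soon as possible on an available machine, subject to the constraints above given the jobs already scheduled. *)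

(* Defs.v *)
From HB Require Import structures.
From mathcomp Require Import all_boot all_order all_algebra all_fingroup.

Set Implicit Arguments.
Unset Strict Implicit.
Unset Printing Implicit Defensive.

Import Order.TTheory GRing.Theory Num.Theory.
Local Open Scope ring_scope.

Record instance (R : realFieldType) (n : nat) := Instance {
  load : 'I_n -> R;
  proc : 'I_n -> nat;
  unload : 'I_n -> R;
  load_gt0 : forall j, 0 < load j;
  proc_gt0 : forall j, (0 < proc j)%N;
  unload_gt0 : forall j, 0 < unload j
}.

Section Scheduling.
Variables (R : realFieldType) (n : nat) (I : instance R n).

Definition job_length (j : 'I_n) : R := load I j + (proc I j)%:R + unload I j.

(* A machine together with the starting time of the loading on that machine.
   As no delay is allowed inside a job, this fixes all the operations of the
   job. *)
Definition slot : Type := ('I_2 * R)%type.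

Definition unload_start (j : 'I_n) (a : slot) : R :=
  a.2 + load I j + (proc I j)%:R.

Definition completion (j : 'I_n) (a : slot) : R := a.2 + job_length j.

(* The intervals [x, x'[ and [y, y'[, assumed nonempty, do not overlap. *)
Definition disjoint_itv (x x' y y' : R) : bool := (x' <= y) || (y' <= x).

Definition machine_compatible (i : 'I_n) (a : slot) (j : 'I_n) (b : slot) :=
  (a.1 == b.1) ==> disjoint_itv a.2 (completion i a) b.2 (completion j b).

(* The two server operations of i overlap neither of those of j. *)
Definition server_compatible (i : 'I_n) (a : slot) (j : 'I_n) (b : slot) :=
  [&& disjoint_itv a.2 (a.2 + load I i) b.2 (b.2 + load I j),
      disjoint_itv a.2 (a.2 + load I i) (unload_start j b) (completion j b),
      disjoint_itv (unload_start i a) (completion i a) b.2 (b.2 + load I j)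
    & disjoint_itv (unload_start i a) (completion i a)
                   (unload_start j b) (completion j b)].

Definition compatible (i : 'I_n) (a : slot) (j : 'I_n) (b : slot) :=
  machine_compatible i a j b && server_compatible i a j b.

Definition schedule : Type := 'I_n -> slot.

Definition feasible (S : schedule) : Prop :=
  (forall j, 0 <= (S j).2) /\
  (forall i j, i != j -> compatible i (S i) j (S j)).

(* Completion times of feasible schedules are positive, so the default value 0
   of the maximum is only reached when there is no job. *)
Definition makespan (S : schedule) : R :=
  \big[Num.max/0]_(j < n) completion j (S j).

Definition optimal (S : schedule) : Prop :=
  feasible S /\ forall S', feasible S' -> makespan S <= makespan S'.

Definition optimal_makespan (C : R) : Prop :=
  exists2 S, optimal S & makespan S = C.

(* The job in position k of the permutation can occupy slot a, given the slots
   in S of the jobs in the positions before k. *)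
Definition admissible (pi : {perm 'I_n}) (S : schedule) (k : 'I_n) (a : slot) :
    Prop :=
  0 <= a.2 /\
  forall l : 'I_n, (l < k)%N -> compatible (pi l) (S (pi l)) (pi k) a.

(* This is a relation because several machines may allow the earliest starting
   time; all the ways of breaking such ties are allowed. *)
Definition defined_by (pi : {perm 'I_n}) (S : schedule) : Prop :=
  forall k : 'I_n,
    admissible pi S k (S (pi k)) /\
    forall a : slot, admissible pi S k a -> (S (pi k)).2 <= a.2.

End Scheduling.

(* Main.v *)
Require Import Defs.
From mathcomp Require Import all_boot all_order all_algebra all_fingroup.
From mathcomp Require Import lra.

(** Loadings last longer than processings, so the server cannot serve another
    job while a job is being processed: the loading of the other job would have
    to fit between the loading and the unloading of the first.  Hence compatible
    jobs never overlap at all, even on different machines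
    ([compatible_disjoint]), and the two machines are worth no more than one.

    Two consequences give the theorem.  Every feasible schedule packs disjoint
    intervals of the lengths of the jobs into [0, makespan], so its makespan is
    at least the total length ([sum_length_le_makespan]).  And the schedule
    defined by a permutation has no idle time: the first [k] jobs fill the
    interval from [0] to the sum of their lengths, so the next job starts
    exactly at that sum ([defined_by_start]), and the last one ends at the total
    length. *)

Set Implicit Arguments.
Unset Strict Implicit.
Unset Printing Implicit Defensive.

Import Order.TTheory GRing.Theory Num.Theory.
Local Open Scope ring_scope.

Lemma disjoint_itvC (R : realFieldType) (x x' y y' : R) :
  disjoint_itv x x' y y' = disjoint_itv y y' x x'.
Proof. exact: orbC. Qed.

(** Among pairwise disjoint intervals, all those other than the one that starts
    last end before its start, which allows an induction on their number. *)
Lemma sum_disjoint_le (R : realFieldType) (T : finType) (x len : T -> R)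
    (A : {set T}) (t : R) :
    (forall i, 0 < len i) -> (forall i, 0 <= x i) ->
    (forall i j, i != j -> disjoint_itv (x i) (x i + len i) (x j) (x j + len j)) ->
    0 <= t -> (forall i, i \in A -> x i + len i <= t) ->
  \sum_(i in A) len i <= t.
Proof.
move=> len_gt0 x_ge0 disj.
have [m] := ubnP #|A|; elim: m => // m IHm in A t *.
rewrite ltnS => cardA t_ge0 endA.
have [->|[i0 Ai0]] := set_0Vmem A; first by rewrite big_set0.
have [i Ai max_i] : exists2 i, i \in A & {in A, forall j, x j <= x i}.
  by case: (arg_maxP x Ai0) => i; exists i.
rewrite (big_setD1 i Ai) /=.
suff le_xi : \sum_(j in A :\ i) len j <= x i by have := endA i Ai; lra.
apply: IHm => //; first by move: cardA; rewrite (cardsD1 i A) Ai.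
move=> j; rewrite !inE => /andP[ne_ji Aj].
have le_ji := max_i j Aj.
by case/orP: (disj j i ne_ji) => //; have := len_gt0 i; lra.
Qed.

Section Jobs.
Variables (R : realFieldType) (n : nat) (I : instance R n).
Implicit Types (i j k l : 'I_n) (a b : slot R) (S : schedule R n).
Implicit Type pi : {perm 'I_n}.

Lemma job_length_gt0 j : 0 < job_length I j.
Proof.
have := (load_gt0 I j, unload_gt0 I j, ler0n R (proc I j)).
by rewrite /job_length => -[[]]; lra.
Qed.

Lemma compatibleC i a j b : compatible I i a j b = compatible I j b i a.
Proof.
rewrite /compatible /machine_compatible /server_compatible eq_sym.
rewrite (disjoint_itvC a.2 (completion I i a)).
rewrite (disjoint_itvC a.2 (a.2 + load I i)).
rewrite (disjoint_itvC a.2 (a.2 + load I i)).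
rewrite (disjoint_itvC (unload_start I i a) _ b.2).
rewrite (disjoint_itvC (unload_start I i a) _ (unload_start I j b)).
by congr (_ && (_ && _)); rewrite andbCA.
Qed.

Lemma compatible_before i a j b : completion I i a <= b.2 -> compatible I i a j b.
Proof.
have := (load_gt0 I i, unload_gt0 I i, ler0n R (proc I i)).
have := (load_gt0 I j, unload_gt0 I j, ler0n R (proc I j)).
rewrite /compatible /machine_compatible /server_compatible /disjoint_itv.
rewrite /unload_start /completion /job_length.
move=> [[si ti] pi] [[sj tj] pj] le_ab.
apply/andP; split; first by apply/implyP => _; apply/orP; left.
by apply/and4P; split; apply/orP; left; lra.
Qed.

(** Time elapsed when the jobs in the first [m] positions of [pi] are executed
    one after the other without idle time. *)
Definition elapsed pi (m : nat) : R := \sum_(l < n | (l < m)%N) job_length I (pi l).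

Lemma elapsed0 pi : elapsed pi 0 = 0.
Proof. by rewrite /elapsed big_pred0. Qed.

Lemma elapsedS pi k : elapsed pi k.+1 = elapsed pi k + job_length I (pi k).
Proof.
rewrite /elapsed (bigD1 k) //= addrC; congr (_ + _).
by apply: eq_bigl => l; rewrite ltnS [RHS]ltn_neqAle andbC.
Qed.

Lemma elapsed_total pi : elapsed pi n = \sum_j job_length I j.
Proof.
rewrite [RHS](reindex_inj (@perm_inj _ pi)) /elapsed.
by apply: eq_bigl => l; rewrite ltn_ord.
Qed.

Lemma le_elapsed pi : {homo elapsed pi : m p / (m <= p)%N >-> m <= p}.
Proof.
move=> m p le_mp; rewrite /elapsed big_mkcond [leRHS]big_mkcond.
apply: ler_sum => q _; case: ltnP => [lt_qm | _].
  by rewrite (leq_trans lt_qm le_mp).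
by case: ifP => // _; apply/ltW/job_length_gt0.
Qed.

Lemma elapsed_ge0 pi m : 0 <= elapsed pi m.
Proof. by rewrite -(elapsed0 pi); apply: le_elapsed. Qed.

Lemma admissible_elapsed pi S k a :
    (forall l, (l < k)%N -> (S (pi l)).2 = elapsed pi l) ->
    elapsed pi k <= a.2 -> admissible I pi S k a.
Proof.
move=> start_lt le_a; split; first exact: le_trans (elapsed_ge0 pi k) le_a.
move=> l lt_lk; apply: compatible_before.
rewrite /completion start_lt // -elapsedS.
exact: le_trans (le_elapsed pi lt_lk) le_a.
Qed.

Lemma completion_le_makespan S j : completion I j (S j) <= makespan I S.
Proof. exact: (le_bigmax _ (fun j => completion I j (S j))). Qed.

Lemma defined_by_feasible pi S : defined_by I pi S -> feasible I S.
Proof.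
move=> defS.
have compat_lt k l : (l < k)%N -> compatible I (pi l) (S (pi l)) (pi k) (S (pi k)).
  by case: (defS k) => -[_ compat_k] _; apply: compat_k.
split=> [j | i j ne_ij].
  by rewrite -(permKV pi j); case: (defS (pi^-1 j)%g) => -[].
rewrite -(permKV pi i) -(permKV pi j).
case: (ltngtP (pi^-1 i)%g (pi^-1 j)%g) => [lt_ij | lt_ji | /val_inj/perm_inj eq_ij].
- exact: compat_lt.
- by rewrite compatibleC; apply: compat_lt.
- by rewrite eq_ij eqxx in ne_ij.
Qed.

Section ShortProcessing.
Hypothesis proc_lt_load : forall i j, (proc I j)%:R < load I i.

(** Say that [i] is loaded before [j].  The loading of [j] is then either before
    or after the unloading of [i]; if before, it lies within the processing of
    [i], which is too short. *)
Lemma compatible_disjoint i a j b : compatible I i a j b ->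
  disjoint_itv a.2 (completion I i a) b.2 (completion I j b).
Proof.
case/andP=> _ /and4P[loads load_unload unload_load _].
move: loads load_unload unload_load.
have := (load_gt0 I i, unload_gt0 I i, proc_lt_load j i).
have := (load_gt0 I j, unload_gt0 I j, proc_lt_load i j).
rewrite /disjoint_itv /completion /unload_start /job_length.
move=> [[sj tj] pj] [[si ti] pi].
case/orP=> [le_ij _ | le_ji].
  by case/orP=> [le_Cb | le_ba]; apply/orP; [left | exfalso]; lra.
by case/orP=> [le_ab | le_Ca] _; apply/orP; [exfalso | right]; lra.
Qed.

Lemma sum_length_le_makespan S :
  feasible I S -> \sum_j job_length I j <= makespan I S.
Proof.
move=> [start_ge0 compat].
rewrite -[leLHS](eq_bigl _ _ (fun j => in_setT j)).
apply: (@sum_disjoint_le _ _ (fun j => (S j).2)) => // [j|i j ne_ij||j _].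
- exact: job_length_gt0.
- exact: compatible_disjoint (compat i j ne_ij).
- exact: bigmax_ge_id.
- exact: completion_le_makespan.
Qed.

(** The jobs before position [k] leave no gap before [elapsed pi k]: a job
    disjoint from all of them and starting after the first [m] of them also
    starts after the next one, since it cannot end before its own start. *)
Lemma elapsed_le_admissible pi S k a :
    (forall l, (l < k)%N -> (S (pi l)).2 = elapsed pi l) ->
    admissible I pi S k a -> elapsed pi k <= a.2.
Proof.
move=> start_lt [a_ge0 compat_a].
suff le_a m : (m <= k)%N -> elapsed pi m <= a.2 by exact: le_a.
elim: m => [_ | m IHm lt_mk]; first by rewrite elapsed0.
pose l := Ordinal (ltn_trans lt_mk (ltn_ord k)).
rewrite (elapsedS pi l).
have := compatible_disjoint (compat_a l lt_mk).
rewrite /disjoint_itv /completion start_lt //=.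
case/orP=> // le_al; have := job_length_gt0 (pi k).
by have := IHm (ltnW lt_mk); lra.
Qed.

Lemma defined_by_start pi S k : defined_by I pi S -> (S (pi k)).2 = elapsed pi k.
Proof.
move=> defS; have [m] := ubnP (k : nat); elim: m => // m IHm in k *.
rewrite ltnS => le_km.
have start_lt l : (l < k)%N -> (S (pi l)).2 = elapsed pi l.
  by move=> lt_lk; apply: IHm; apply: leq_trans lt_lk le_km.
have [adm min_k] := defS k.
apply/le_anti; rewrite (elapsed_le_admissible start_lt adm) andbT.
by apply: (min_k (ord0, elapsed pi k)); apply: admissible_elapsed start_lt _.
Qed.

Lemma makespan_defined_by pi S :
  defined_by I pi S -> makespan I S = \sum_j job_length I j.
Proof.
move=> defS; apply/le_anti/andP; split; last first.
  exact: sum_length_le_makespan (defined_by_feasible defS).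
rewrite -(elapsed_total pi); apply: bigmax_le => [|j _].
  exact: elapsed_ge0.
rewrite -(permKV pi j) /completion (defined_by_start _ defS) -elapsedS.
by apply: le_elapsed; apply: ltn_ord.
Qed.

Lemma defined_by_optimal pi S : defined_by I pi S -> optimal I S.
Proof.
move=> defS; split; first exact: defined_by_feasible defS.
by move=> S' feasS'; rewrite (makespan_defined_by defS) sum_length_le_makespan.
Qed.

(** Executing all the jobs without idle time on a single machine is one of the
    schedules defined by the permutation. *)
Lemma defined_by_exists pi : exists S, defined_by I pi S.
Proof.
exists (fun j => (ord0, elapsed pi (pi^-1 j)%g)) => k; rewrite permK.
split=> [|a]; [apply: admissible_elapsed | apply: elapsed_le_admissible] => //=.
  by move=> l _; rewrite permK.
by move=> l _; rewrite permK.
Qed.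

End ShortProcessing.
End Jobs.

Theorem proposition6 (R : realFieldType) (n : nat) (I : instance R n)
    (hps : forall i j : 'I_n, (proc I j)%:R < load I i) :
  (forall pi : {perm 'I_n},
     (exists S : schedule R n, defined_by I pi S) /\
     (forall S : schedule R n, defined_by I pi S -> optimal I S)) /\
  optimal_makespan I (\sum_(j < n) job_length I j).
Proof.
split=> [pi | ].
  by split=> [|S]; [exact: defined_by_exists | exact: defined_by_optimal].
have [S defS] := defined_by_exists hps 1%g.
by exists S; [exact: defined_by_optimal defS | exact: makespan_defined_by defS].
Qed.
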